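(* Each of the following triples $(c,\alpha,\beta)$ is a solution of the right fish equation: (1) $c(i,j)=t_iz_j+z_i$, $\alpha(i,j)=t_j$, $\beta(i,j)=-1$; (2) $c(i,j)=t_iz_j+z_i$, $\alpha(i,j)=z_j$, $\beta(i,j)=z_i$; (3) $c(i,j)=t_jz_i+z_j$, $\alpha(i,j)=(t_j+1)z_jt_i$, $\beta(i,j)=(t_i+1)z_i$; (4) $c(i,j)=t_jz_i+z_j$, $\alpha(i,j)=-(t_j+1)$, $\beta(i,j)=t_i+1$. Moreover, if $(c,\alpha_1,\beta_1)$ and $(c,\alpha_2,\beta_2)$ are solutions with the same $c$, then $(c,\lambda\alpha_1+\mu\alpha_2,\lambda\beta_1+\mu\beta_2)$ is a solution for all constants $\lambda,\mu\in\mathbb{C}$ (independent of $z_i,z_j,t_i,t_j$).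
   Context: Let $\alpha(i,j),\beta(i,j),c(i,j)$ denote expressions in complex variables $z_i,t_i,z_j,t_j$, and let $\alpha(j,i)$ denote the same expression with $(z_i,t_i)$ and $(z_j,t_j)$ interchanged (similarly for $\beta$). The triple $(c,\alpha,\beta)$ is a solution of the right fish equation if, identically in $z_i,z_j,t_i,t_j$, $$(t_i+1)z_i\,\beta(j,i)+(z_i-z_j)\,\alpha(j,i)=c(i,j)\,\beta(i,j),$$ $$(t_j+1)z_j\,\alpha(j,i)+(t_iz_j-t_jz_i)\,\beta(j,i)=c(i,j)\,\alpha(i,j).$$ *)

(* Defs.v *)
From Stdlib Require Import Reals.
From Coquelicot Require Export Coquelicot.

(* An expression f(i,j) in z_i, t_i, z_j, t_j is the function
   f zi ti zj tj, so that f(j,i) is f zj tj zi ti. *)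
Definition expression : Type := C -> C -> C -> C -> C.

Local Open Scope C_scope.

Definition right_fish_solution (c alpha beta : expression) : Prop :=
  forall zi ti zj tj : C,
    (ti + 1) * zi * beta zj tj zi ti + (zi - zj) * alpha zj tj zi ti
      = c zi ti zj tj * beta zi ti zj tj
    /\
    (tj + 1) * zj * alpha zj tj zi ti
      + (ti * zj - tj * zi) * beta zj tj zi ti
      = c zi ti zj tj * alpha zi ti zj tj.

(* Main.v *)
Require Import Defs.
From Stdlib Require Import Reals.
From Coquelicot Require Import Coquelicot.

Local Open Scope C_scope.

(** For fixed [c], the two equations say that a 2×2 matrix in [zi], [ti], [zj], [tj] sends the
    vector of swapped values (β(j,i), α(j,i)) to [c] times (β(i,j), α(i,j)). Both sides are linear
    in the pair (α, β), and the swap leaves the constants [lambda] and [mu] fixed, so solutions with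
    a common [c] can be superposed. For the four explicit triples, each equation is a polynomial
    identity over [C]. *)

Lemma right_fish_solution_linear_combination
    (c alpha1 beta1 alpha2 beta2 : expression) (lambda mu : C) :
  right_fish_solution c alpha1 beta1 ->
  right_fish_solution c alpha2 beta2 ->
  right_fish_solution c
    (fun zi ti zj tj : C =>
       lambda * alpha1 zi ti zj tj + mu * alpha2 zi ti zj tj)
    (fun zi ti zj tj : C =>
       lambda * beta1 zi ti zj tj + mu * beta2 zi ti zj tj).
Proof.
  intros H1 H2 zi ti zj tj.
  destruct (H1 zi ti zj tj) as [P1 Q1], (H2 zi ti zj tj) as [P2 Q2].
  split.
  (* The intermediate term displays the right-hand sides of [P1] and [P2] verbatim, so that both can
     be rewritten backwards. *)
  - transitivity (lambda * (c zi ti zj tj * beta1 zi ti zj tj)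
                  + mu * (c zi ti zj tj * beta2 zi ti zj tj)); [|ring].
    rewrite <- P1, <- P2; ring.
  - transitivity (lambda * (c zi ti zj tj * alpha1 zi ti zj tj)
                  + mu * (c zi ti zj tj * alpha2 zi ti zj tj)); [|ring].
    rewrite <- Q1, <- Q2; ring.
Qed.

Theorem theorem6p1 :
  right_fish_solution
    (fun zi ti zj tj : C => ti * zj + zi)
    (fun zi ti zj tj : C => tj)
    (fun zi ti zj tj : C => - (1)) /\
  right_fish_solution
    (fun zi ti zj tj : C => ti * zj + zi)
    (fun zi ti zj tj : C => zj)
    (fun zi ti zj tj : C => zi) /\
  right_fish_solution
    (fun zi ti zj tj : C => tj * zi + zj)
    (fun zi ti zj tj : C => (tj + 1) * zj * ti)
    (fun zi ti zj tj : C => (ti + 1) * zi) /\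
  right_fish_solution
    (fun zi ti zj tj : C => tj * zi + zj)
    (fun zi ti zj tj : C => - (tj + 1))
    (fun zi ti zj tj : C => ti + 1) /\
  (forall c alpha1 beta1 alpha2 beta2 : expression,
    right_fish_solution c alpha1 beta1 ->
    right_fish_solution c alpha2 beta2 ->
    forall lambda mu : C,
      right_fish_solution c
        (fun zi ti zj tj : C =>
           lambda * alpha1 zi ti zj tj + mu * alpha2 zi ti zj tj)
        (fun zi ti zj tj : C =>
           lambda * beta1 zi ti zj tj + mu * beta2 zi ti zj tj)).
Proof.
  (* [ring] settles all four explicit triples; only the superposition clause survives the [try]. *)
  repeat apply conj; try (intros zi ti zj tj; split; ring).
  intros c alpha1 beta1 alpha2 beta2 H1 H2 lambda mu.
  now apply right_fish_solution_linear_combination.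
Qed.
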